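(* Let $\mathcal A$ be a countable structure. The following are equivalent: (1) There is a continuous group isomorphism between $\mathrm{Aut}(\mathcal A)$ and $\mathrm{Aut}(\mathbb Q,<)$. (2) There are $n\in\omega$, an $\mathcal L_{\omega_1\omega}$-definable (without parameters) set $D\subseteq A^n$, an $\mathcal L_{\omega_1\omega}$-definable equivalence relation $E\subseteq D^2$ with infinitely many equivalence classes, and an $\mathcal L_{\omega_1\omega}$-definable order on the $E$-classes, such that the $E$-equivalence classes are order indiscernible (each order-preserving permutation of the $E$-classes extends to an automorphism of $\mathcal A$), and every other element is definable from this set: if we add to $\mathcal A$ relations naming each of the $E$-equivalence classes, then every element of the expanded structure is $\mathcal L_{\omega_1\omega}$-definable.
   Context: $\mathcal A$ has domain $\omega$; automorphism groups carry the topology of pointwise convergence. An automorphism $g$ of $\mathcal A$ extends a permutation $h$ of the $E$-classes if $g$, acting coordinatewise on $A^n$, maps each $E$-class $C$ onto $h(C)$.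
   Formalization: ''Order indiscernible'' here also requires that any two increasing finite sequences of E-classes of equal length are conjugate under Aut(A); with the parenthetical condition alone, (ω,<) with E equality satisfies (2) but not (1). *)

(* Defs.v *)
From HB Require Import structures.
From mathcomp Require Import all_boot all_order all_algebra.
From mathcomp Require Import all_classical all_reals all_analysis.

Set Implicit Arguments.
Unset Strict Implicit.
Unset Printing Implicit Defensive.

Import Order.TTheory GRing.Theory Num.Theory.
Local Open Scope classical_set_scope.

Record language := Language {
  fun_sym : Type;
  fun_arity : fun_sym -> nat;
  rel_sym : Type;
  rel_arity : rel_sym -> nat }.

Record structure (L : language) (A : Type) := Structure {
  finterp : forall f : fun_sym L, (fun_arity f).-tuple A -> A;
  rinterp : forall r : rel_sym L, set ((rel_arity r).-tuple A) }.

Inductive term (L : language) (k : nat) : Type :=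
| Var of 'I_k
| App (f : fun_sym L) of ('I_(fun_arity f) -> term L k).

(* [formula L k] is the type of formulas whose free variables are among the k
   variables indexed by 'I_k; a quantifier binds the variable of index 0 of
   its body and shifts the other ones. *)
Inductive formula (L : language) : nat -> Type :=
| FRel k (r : rel_sym L) of ('I_(rel_arity r) -> term L k) : formula L k
| FEq k of term L k & term L k : formula L k
| FNot k of formula L k : formula L k
| FAnd k (J : countType) of (J -> formula L k) : formula L k
| FOr k (J : countType) of (J -> formula L k) : formula L k
| FEx k of formula L k.+1 : formula L k
| FAll k of formula L k.+1 : formula L k.

Section Semantics.
Variables (L : language) (A : Type) (M : structure L A).

Fixpoint eval_term k (v : k.-tuple A) (t : term L k) : A :=
  match t with
  | Var i => tnth v i
  | App f ts => finterp M (mktuple (fun i => eval_term v (ts i)))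
  end.

Fixpoint sat k (phi : formula L k) : k.-tuple A -> Prop :=
  match phi in formula _ k return k.-tuple A -> Prop with
  | FRel _ r ts => fun v => rinterp M (mktuple (fun i => eval_term v (ts i)))
  | FEq _ t u => fun v => eval_term v t = eval_term v u
  | FNot _ psi => fun v => ~ sat psi v
  | FAnd _ J psi => fun v => forall i : J, sat (psi i) v
  | FOr _ J psi => fun v => exists i : J, sat (psi i) v
  | FEx _ psi => fun v => exists x : A, sat psi [tuple of x :: v]
  | FAll _ psi => fun v => forall x : A, sat psi [tuple of x :: v]
  end.

Definition definable n (D : set (n.-tuple A)) : Prop :=
  exists phi : formula L n, forall a, D a <-> sat phi a.

Definition definable2 n (R : n.-tuple A -> n.-tuple A -> Prop) : Prop :=
  exists phi : formula L (n + n),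
    forall a b, R a b <-> sat phi [tuple of a ++ b].

Definition definable_elt (x : A) : Prop := definable [set [tuple x]].

Definition is_automorphism (g : A -> A) : Prop :=
  [/\ bijective g,
      forall (f : fun_sym L) (a : (fun_arity f).-tuple A),
        g (finterp M a) = finterp M (map_tuple g a)
    & forall (r : rel_sym L) (a : (rel_arity r).-tuple A),
        rinterp M (map_tuple g a) <-> rinterp M a].

End Semantics.

(* The expansion of [M] by one n-ary relation naming each member of [F]. *)
Definition naming_language (L : language) n (A : Type)
    (F : set (set (n.-tuple A))) : language :=
  Language (@fun_arity L)
    (fun r : rel_sym L + F =>
       match r with inl r => rel_arity r | inr _ => n end).

Definition naming_expansion (L : language) n (A : Type) (M : structure L A)
    (F : set (set (n.-tuple A))) : structure (naming_language L F) A :=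
  @Structure (naming_language L F) A (@finterp L A M)
    (fun r => match r with
              | inl r => @rinterp L A M r
              | inr C => set_val C
              end).

Record aut (L : language) (A : Type) (M : structure L A) := Aut {
  aut_fun :> A -> A;
  autP : is_automorphism M aut_fun }.

Section AutGroup.
Variables (L : language) (A : choiceType) (M : structure L A).

Lemma aut_inj (g h : aut M) : aut_fun g = aut_fun h -> g = h.
Proof.
case: g h => [g gP] [h hP] /= e; move: gP hP; rewrite e => gP hP.
by rewrite (Prop_irrelevance gP hP).
Qed.

Fact aut_one_subproof : is_automorphism M (@idfun A).
Proof.
have E k (a : k.-tuple A) : map_tuple idfun a = a.
  by apply: val_inj; rewrite /= map_id.
by split=> [|f a|r a]; [exists id | rewrite E | rewrite E].
Qed.
Definition aut_one : aut M := Aut aut_one_subproof.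

Fact aut_mul_subproof (g h : aut M) : is_automorphism M (g \o h).
Proof.
have E k (a : k.-tuple A) : map_tuple (g \o h) a = map_tuple g (map_tuple h a).
  by apply: val_inj; rewrite /= map_comp.
case: (autP g) (autP h) => gb gf gr [hb hf hr].
by split=> [|f a|r a]; [exact: bij_comp | rewrite E /= hf gf | rewrite E gr hr].
Qed.
Definition aut_mul (g h : aut M) : aut M := Aut (aut_mul_subproof g h).

Fact aut_inv_subproof (g : aut M) :
  exists2 h : A -> A, cancel g h & cancel h g.
Proof. by case: (autP g) => -[h gK hK] _ _; exists h. Qed.
Definition aut_inv_fun (g : aut M) : A -> A :=
  s2val (cid2 (aut_inv_subproof g)).
Lemma aut_inv_funK (g : aut M) : cancel g (aut_inv_fun g).
Proof. exact: s2valP (cid2 (aut_inv_subproof g)). Qed.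
Lemma aut_funK (g : aut M) : cancel (aut_inv_fun g) g.
Proof. exact: s2valP' (cid2 (aut_inv_subproof g)). Qed.

Fact aut_inv_is_automorphism (g : aut M) : is_automorphism M (aut_inv_fun g).
Proof.
have E k (a : k.-tuple A) : map_tuple g (map_tuple (aut_inv_fun g) a) = a.
  by apply: val_inj; rewrite /= -map_comp (eq_map (aut_funK g)) map_id.
case: (autP g) => gb gf gr; split=> [|f a|r a].
- by exists g; [exact: aut_funK | exact: aut_inv_funK].
- by apply: (bij_inj gb); rewrite aut_funK gf E.
- by rewrite -gr E.
Qed.
Definition aut_inv (g : aut M) : aut M := Aut (aut_inv_is_automorphism g).

HB.instance Definition _ := gen_eqMixin (aut M).
HB.instance Definition _ := gen_choiceMixin (aut M).

Fact aut_mulA : associative aut_mul.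
Proof. by move=> g h k; apply: aut_inj. Qed.
Fact aut_mul1 : left_id aut_one aut_mul.
Proof. by move=> g; apply: aut_inj. Qed.
Fact aut_1mul : right_id aut_one aut_mul.
Proof. by move=> g; apply: aut_inj. Qed.
Fact aut_mulV : left_inverse aut_one aut_inv aut_mul.
Proof.
by move=> g; apply: aut_inj; apply/funext => x /=; rewrite aut_inv_funK.
Qed.
Fact aut_mulgV : right_inverse aut_one aut_inv aut_mul.
Proof. by move=> g; apply: aut_inj; apply/funext => x /=; rewrite aut_funK. Qed.

HB.instance Definition _ := isGroup.Build (aut M)
  aut_mulA aut_mul1 aut_1mul aut_mulV aut_mulgV.

(* Pointwise convergence: the subspace topology of the product A^A, where A is
   discrete.  The alias [discrete_topology] is needed because [rat] carries its
   metric topology by default. *)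
HB.instance Definition _ := Topological.copy (aut M)
  (initial_topology
     (fun g : aut M => (aut_fun g : {ptws A -> discrete_topology A}))).

End AutGroup.

Definition order_language : language :=
  @Language void (fun _ => 0) unit (fun _ => 2).

Definition rat_order : structure order_language rat :=
  @Structure order_language rat
    (fun f : void => match f with end)
    (fun _ (a : 2.-tuple rat) => (tnth a ord0 < tnth a ord_max)%R).

Section Classes.
Variables (A : Type) (n : nat) (D : set (n.-tuple A)).
Variable E : n.-tuple A -> n.-tuple A -> Prop.

Definition equivalence_on : Prop :=
  [/\ forall a b, E a b -> D a /\ D b,
      forall a, D a -> E a a,
      forall a b, E a b -> E b a
    & forall a b c, E a b -> E b c -> E a c].

Definition eclass (a : n.-tuple A) : set (n.-tuple A) := [set b | E a b].

Definition eclasses : set (set (n.-tuple A)) := [set eclass a | a in D].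

Variable lt : set (n.-tuple A) -> set (n.-tuple A) -> Prop.

Definition strict_linear_order_on_classes : Prop :=
  [/\ forall C, eclasses C -> ~ lt C C,
      forall C1 C2 C3, eclasses C1 -> eclasses C2 -> eclasses C3 ->
        lt C1 C2 -> lt C2 C3 -> lt C1 C3
    & forall C1 C2, eclasses C1 -> eclasses C2 ->
        [\/ lt C1 C2, C1 = C2 | lt C2 C1]].

Definition order_preserving_permutation
    (h : set (n.-tuple A) -> set (n.-tuple A)) : Prop :=
  set_bij eclasses eclasses h /\
  forall C1 C2, eclasses C1 -> eclasses C2 -> lt C1 C2 -> lt (h C1) (h C2).

Definition increasing_classes k (C : 'I_k -> set (n.-tuple A)) : Prop :=
  (forall i, eclasses (C i)) /\ (forall i j : 'I_k, i < j -> lt (C i) (C j)).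

Variables (L : language) (M : structure L A).

Definition extends (g : aut M) (h : set (n.-tuple A) -> set (n.-tuple A)) :=
  forall C, eclasses C -> [set map_tuple g a | a in C] = h C.

(* The first clause is order indiscernibility in the model-theoretic sense, up
   to automorphism: any two finite increasing sequences of classes of the same
   length are conjugate.  The second clause alone does not imply it: for the
   structure (omega, <), with E the equality and lt the usual order, the only
   order-preserving permutation is the identity. *)
Definition order_indiscernible : Prop :=
  (forall k (C C' : 'I_k -> set (n.-tuple A)),
     increasing_classes C -> increasing_classes C' ->
     exists g : aut M, forall i, [set map_tuple g a | a in C i] = C' i) /\
  (forall h, order_preserving_permutation h -> exists g : aut M, extends g h).

End Classes.

(* Main.v *)
(* A permutation group on a countable set is compared with its invariant
   relations.  For a countable structure, tuples with the same
   L_{omega_1 omega}-type are conjugate (back and forth), so the invariant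
   relations are exactly the definable ones.

   Given a continuous isomorphism f onto Aut(Q, <), continuity provides a tuple
   a whose stabilizer is mapped into the stabilizer of 0, so g a |-> f g 0 is an
   equivariant surjection from the orbit of a onto Q.  Its fibres are the
   classes; an automorphism fixing all of them has trivial image under f, hence
   is trivial.

   Conversely, finite indiscernibility makes the countable order of the classes
   dense and unbounded, hence isomorphic to Q; transporting the action on the
   classes along this isomorphism is injective because every element is
   definable from the classes, and surjective by the extension property. *)
Require Import Defs.
From HB Require Import structures.
From mathcomp Require Import all_boot all_order all_algebra.
From mathcomp Require Import all_classical all_reals all_analysis.

Set Implicit Arguments.
Unset Strict Implicit.
Unset Printing Implicit Defensive.

Import Order.TTheory GRing.Theory Num.Theory.
Local Open Scope classical_set_scope.

(** * The back-and-forth construction *)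

Lemma unpickle_surj (T : countType) (x : T) : exists n, unpickle n = Some x.
Proof. by exists (pickle x); exact: pickleK. Qed.

Section BackAndForth.
Variables (X Y : choiceType) (eX : nat -> option X) (eY : nat -> option Y).
Hypothesis eX_surj : forall x, exists n, eX n = Some x.
Hypothesis eY_surj : forall y, exists n, eY n = Some y.
Variable P : seq (X * Y) -> Prop.
Hypothesis P_inj : forall s p q,
  P s -> p \in s -> q \in s -> (p.1 = q.1 <-> p.2 = q.2).
Hypothesis forth : forall s x, P s -> exists y, P ((x, y) :: s).
Hypothesis back : forall s y, P s -> exists x, P ((x, y) :: s).

(** An increasing chain of lists in [P] takes in the n-th elements of [X] and [Y] at stage n; by
    [P_inj] their union is the graph of a bijection. The last clause speaks of a larger list because
    [P] is not assumed to pass to sublists. *)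
Lemma back_and_forth s0 : P s0 ->
  exists g : X -> Y,
  [/\ bijective g,
      forall p, p \in s0 -> g p.1 = p.2
    & forall l : seq X, exists2 s, P s & forall x, x \in l -> (x, g x) \in s].
Proof.
move=> Ps0.
(* [P s] is a premise inside the existential, so that choice gives a step function on all lists. *)
have stepP s n : exists t, P s -> [/\ P t, {subset s <= t},
    forall x, eX n = Some x -> exists y, (x, y) \in t
  & forall y, eY n = Some y -> exists x, (x, y) \in t].
  have [Ps|nPs] := pselect (P s); last by exists s.
  have [s1 [Ps1 ss1 s1X]] : exists s1, [/\ P s1, {subset s <= s1}
      & forall x, eX n = Some x -> exists y, (x, y) \in s1].
    case: (eX n) => [x|]; last by exists s; split.
    have [y Py] := forth x Ps; exists ((x, y) :: s); split=> //.
      by move=> p ps; rewrite inE ps orbT.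
    by move=> _ [<-]; exists y; rewrite mem_head.
  case: (eY n) => [y|]; last by exists s1; split.
  have [x Px] := back y Ps1; exists ((x, y) :: s1) => _; split=> //.
  - by move=> p ps; rewrite inE ss1 ?orbT.
  - by move=> x' /s1X[y' xy']; exists y'; rewrite inE xy' orbT.
  - by move=> _ [<-]; exists x; rewrite mem_head.
have [step {}stepP] := choice (fun sn : seq (X * Y) * nat => stepP sn.1 sn.2).
pose S := fix S n := if n is m.+1 then step (S m, m) else s0.
have PS n : P (S n) by elim: n => //= n IHn; case: (stepP (S n, n) IHn).
have SS m n : m <= n -> {subset S m <= S n}.
  elim: n m => [|n IHn] m; first by rewrite leqn0 => /eqP ->.
  rewrite leq_eqVlt => /orP[/eqP -> //|/IHn mn] p /mn /=.
  by case: (stepP (S n, n) (PS n)) => _ sub _ _; exact: sub.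
have gP x : exists y n, (x, y) \in S n.
  have [n xn] := eX_surj x; have [_ _ /(_ _ xn)[y ys] _] := stepP (S n, n) (PS n).
  by exists y, n.+1.
have hP y : exists x n, (x, y) \in S n.
  have [n yn] := eY_surj y; have [_ _ _ /(_ _ yn)[x ys]] := stepP (S n, n) (PS n).
  by exists x, n.+1.
have Sinj m n p q : p \in S m -> q \in S n -> (p.1 = q.1 <-> p.2 = q.2).
  move=> pm qn; apply: (P_inj (PS (maxn m n))).
    exact: SS (leq_maxl _ _) _ pm.
  exact: SS (leq_maxr _ _) _ qn.
have [g {}gP] := choice gP; have [h {}hP] := choice hP.
exists g; split.
- exists h => [x|y].
    have [n xn] := gP x; have [m xm] := hP (g x).
    exact/(Sinj _ _ _ _ xm xn).
  have [n yn] := hP y; have [m ym] := gP (h y).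
  exact/(Sinj _ _ _ _ ym yn).
- by move=> p ps; have [n pn] := gP p.1; apply/(Sinj n 0 _ _ pn ps).
- move=> l; suff [n ln] : exists n, forall x, x \in l -> (x, g x) \in S n.
    by exists (S n).
  elim: l => [|x l [n ln]]; first by exists 0.
  have [m xm] := gP x; exists (maxn m n) => x'.
  rewrite inE => /orP[/eqP ->|/ln].
    exact: SS (leq_maxl _ _) _ xm.
  exact: SS (leq_maxr _ _) _.
Qed.

End BackAndForth.

(** * Cantor's theorem on countable dense linear orders without endpoints *)

Definition strict_total_order (T : Type) (lt : T -> T -> Prop) : Prop :=
  [/\ forall x, ~ lt x x,
      forall x y z, lt x y -> lt y z -> lt x z
    & forall x y, [\/ lt x y, x = y | lt y x]].

Definition dense_unbounded (T : Type) (lt : T -> T -> Prop) : Prop :=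
  [/\ exists x : T, True,
      forall x y, lt x y -> exists z, lt x z /\ lt z y,
      forall x, exists y, lt y x
    & forall x, exists y, lt x y].

Lemma strict_total_order_flip (T : Type) (lt : T -> T -> Prop) :
  strict_total_order lt -> strict_total_order (fun x y => lt y x).
Proof.
move=> [irr tr tot]; split=> // [x y z xy yz|x y]; first exact: tr xy.
by case: (tot x y); [constructor 3 | constructor 2 | constructor 1].
Qed.

Lemma strict_total_order_max (T : choiceType) (lt : T -> T -> Prop)
    (x0 : T) (s : seq T) : strict_total_order lt ->
  exists2 m, m \in x0 :: s & forall x, x \in x0 :: s -> x = m \/ lt x m.
Proof.
move=> [_ tr tot]; elim: s x0 => [|y s IHs] x.
  by exists x; rewrite ?mem_head // => y; rewrite inE => /eqP; left.
have [m ms sm] := IHs y; have [xm|xm|mx] := tot x m.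
- exists m; first by rewrite inE ms orbT.
  by move=> z; rewrite inE => /predU1P[->|/sm //]; right.
- exists x; first exact: mem_head.
  by move=> z; rewrite inE xm => /predU1P[|/sm //]; left.
- exists x; first exact: mem_head.
  move=> z; rewrite inE => /predU1P[->|/sm[->|zm]]; [by left|by right|].
  by right; exact: tr mx.
Qed.

(** By density there is a point between the maximum of [l] and the minimum of [u]; if one list is
    empty, the absence of endpoints is used, and if both are, nonemptiness. *)
Lemma dense_unbounded_separation (T : choiceType) (lt : T -> T -> Prop)
    (l u : seq T) :
  strict_total_order lt -> dense_unbounded lt ->
  (forall x y, x \in l -> y \in u -> lt x y) ->
  exists z, (forall x, x \in l -> lt x z) /\ (forall y, y \in u -> lt z y).
Proof.
move=> ltP [[t0 _] dense nomin nomax].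
have maxl x s := strict_total_order_max x s ltP.
have /= minu x s := strict_total_order_max x s (strict_total_order_flip ltP).
have [_ tr _] := ltP.
case: l => [|x l]; case: u => [|y u] lu.
- by exists t0.
- have [m _ um] := minu y u; have [z zm] := nomin m; exists z; split=> // t.
  by move=> /um[->//|]; exact: tr.
- have [m _ lm] := maxl x l; have [z zm] := nomax m; exists z; split=> // t.
  by move=> /lm[->//|tm]; exact: tr tm _.
- have [m ml lm] := maxl x l; have [m' mu um] := minu y u.
  have [z [mz zm]] := dense _ _ (lu _ _ ml mu); exists z; split=> t.
    by move=> /lm[->//|tm]; exact: tr tm _.
  by move=> /um[->//|]; exact: tr.
Qed.

Section Cantor.
Variables (X Y : choiceType) (ltX : X -> X -> Prop) (ltY : Y -> Y -> Prop).

Definition partial_order_isomorphism (s : seq (X * Y)) : Prop :=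
  forall p q, p \in s -> q \in s ->
    (ltX p.1 q.1 <-> ltY p.2 q.2) /\ (p.1 = q.1 <-> p.2 = q.2).

(** The image of a new [x] must lie above the images of the points below [x] and below those of the
    points above it; density separates these two finite sets. *)
Lemma partial_order_isomorphism_forth (s : seq (X * Y)) (x : X) :
  strict_total_order ltX -> strict_total_order ltY -> dense_unbounded ltY ->
  partial_order_isomorphism s ->
  exists y, partial_order_isomorphism ((x, y) :: s).
Proof.
move=> ltXP ltYP dY sP; have [irrX trX totX] := ltXP.
have [irrY trY totY] := ltYP.
have [[p ps px]|xs] := pselect (exists2 p, p \in s & p.1 = x).
  exists p.2; rewrite -px -surjective_pairing => q r.
  by rewrite !inE => /predU1P[->|qs] /predU1P[->|rs]; exact: sP.
pose l := [seq p.2 | p <- s & `[< ltX p.1 x >]].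
pose u := [seq p.2 | p <- s & `[< ltX x p.1 >]].
have [|y [ly yu]] := @dense_unbounded_separation Y ltY l u ltYP dY.
  move=> _ _ /mapP[p pl ->] /mapP[q qu ->].
  move: pl qu; rewrite !mem_filter => /andP[/asboolP px ps] /andP[/asboolP xq qs].
  by have [[+ _] _] := sP _ _ ps qs; apply; exact: trX xq.
have yP p : p \in s -> (ltX p.1 x /\ ltY p.2 y) \/ (ltX x p.1 /\ ltY y p.2).
  move=> ps; have [px|px|xp] := totX p.1 x.
  - left; split=> //; apply: ly; apply/mapP; exists p => //.
    by rewrite mem_filter ps andbT; apply/asboolP.
  - by case: xs; exists p.
  - right; split=> //; apply: yu; apply/mapP; exists p => //.
    by rewrite mem_filter ps andbT; apply/asboolP.
have [irr_eqX irr_eqY] : (forall a b, a = b -> ~ ltX a b) /\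
    (forall a b, a = b -> ~ ltY a b) by split=> a _ <-; [exact: irrX | exact: irrY].
exists y => p q; rewrite !inE => /predU1P[->|ps] /predU1P[->|qs] /=.
- by split; split=> // [/irrX|/irrY].
- have [[a b]|[a b]] := yP q qs; split; split.
  + by move=> /trX-/(_ _ a)/irrX.
  + by move=> /trY-/(_ _ b)/irrY.
  + by move=> /esym/irr_eqX.
  + by move=> /esym/irr_eqY.
  + by [].
  + by [].
  + by move=> /irr_eqX.
  + by move=> /irr_eqY.
- have [[a b]|[a b]] := yP p ps; split; split.
  + by [].
  + by [].
  + by move=> /irr_eqX.
  + by move=> /irr_eqY.
  + by move=> /trX-/(_ _ a)/irrX.
  + by move=> /trY-/(_ _ b)/irrY.
  + by move=> /esym/irr_eqX.
  + by move=> /esym/irr_eqY.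
- exact: sP.
Qed.

End Cantor.

Lemma partial_order_isomorphism_swap (X Y : choiceType)
    (ltX : X -> X -> Prop) (ltY : Y -> Y -> Prop) (s : seq (X * Y)) :
  partial_order_isomorphism ltX ltY s ->
  partial_order_isomorphism ltY ltX [seq (p.2, p.1) | p <- s].
Proof.
move=> sP _ _ /mapP[p ps ->] /mapP[q qs ->] /=.
by split; apply: iff_sym; case: (sP p q ps qs).
Qed.

(** Back and forth with finite partial isomorphisms. Starting from a prescribed list [s] also gives
    the homogeneity of the rationals. *)
Theorem cantor_isomorphism (X Y : choiceType)
    (eX : nat -> option X) (eY : nat -> option Y)
    (ltX : X -> X -> Prop) (ltY : Y -> Y -> Prop) (s : seq (X * Y)) :
  (forall x, exists n, eX n = Some x) -> (forall y, exists n, eY n = Some y) ->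
  strict_total_order ltX -> dense_unbounded ltX ->
  strict_total_order ltY -> dense_unbounded ltY ->
  partial_order_isomorphism ltX ltY s ->
  exists g : X -> Y, [/\ bijective g,
    forall x x', ltX x x' <-> ltY (g x) (g x')
    & forall p, p \in s -> g p.1 = p.2].
Proof.
move=> eXP eYP ltXP dX ltYP dY sP.
have [|||g [gb gs gP]] := @back_and_forth X Y eX eY eXP eYP
  (partial_order_isomorphism ltX ltY) _ _ _ s sP.
- by move=> t p q tP pt qt; case: (tP p q pt qt).
- by move=> t x; exact: partial_order_isomorphism_forth.
- move=> t y /partial_order_isomorphism_swap.
  move=> /(partial_order_isomorphism_forth y ltYP ltXP dX)[x].
  move=> /partial_order_isomorphism_swap; rewrite /= -map_comp /=.
  by under eq_map do rewrite /= -surjective_pairing; rewrite map_id; exists x.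
- exists g; split=> // x x'; have [t tP xt] := gP [:: x; x'].
  have [] := tP (x, g x) (x', g x') => //; apply: xt; rewrite !inE eqxx ?orbT //.
Qed.

(** * Automorphisms preserve formulas and definable sets *)

Lemma map_tuple_cons (T T' : Type) (g : T -> T') k (x : T) (a : k.-tuple T) :
  map_tuple g [tuple of x :: a] = [tuple of g x :: map_tuple g a].
Proof. exact: val_inj. Qed.

Lemma map_tuple_cat (T T' : Type) (g : T -> T') k m
    (a : k.-tuple T) (b : m.-tuple T) :
  map_tuple g [tuple of a ++ b] = [tuple of map_tuple g a ++ map_tuple g b].
Proof. by apply: val_inj; rewrite /= map_cat. Qed.

Section TupleAction.
Variables (L : language) (A : choiceType) (M : structure L A).

Lemma map_tuple_aut_mul (g h : aut M) k (b : k.-tuple A) :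
  map_tuple (aut_mul g h) b = map_tuple g (map_tuple h b).
Proof. by apply: val_inj; rewrite /= map_comp. Qed.

Lemma map_tuple_autK (g : aut M) k (b : k.-tuple A) :
  map_tuple (aut_inv g) (map_tuple g b) = b.
Proof.
by apply: val_inj; rewrite /= -map_comp (eq_map (aut_inv_funK g)) map_id.
Qed.

Lemma map_tuple_autKV (g : aut M) k (b : k.-tuple A) :
  map_tuple g (map_tuple (aut_inv g) b) = b.
Proof.
by apply: val_inj; rewrite /= -map_comp (eq_map (aut_funK g)) map_id.
Qed.

End TupleAction.

Section Automorphisms.
Variables (L : language) (A : choiceType) (M : structure L A) (g : aut M).

Lemma aut_eval_term k (a : k.-tuple A) (t : term L k) :
  eval_term M (map_tuple g a) t = g (eval_term M a t).
Proof.
elim: t => [i|f ts IHts] /=; first by rewrite tnth_map.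
have [_ -> _] := autP g; congr (finterp M _).
by apply: eq_from_tnth => i; rewrite tnth_mktuple IHts tnth_map tnth_mktuple.
Qed.

(** Induction on the formula; since [g] is onto, the values of a quantified variable are carried
    over by [g] and its inverse. *)
Lemma aut_sat k (phi : formula L k) (a : k.-tuple A) :
  sat M phi (map_tuple g a) <-> sat M phi a.
Proof.
have gK := aut_funK g; have [gb _ gr] := autP g.
elim: phi a => {k} [k r ts|k t u|k psi IH|k J psi IH|k J psi IH|k psi IH|k psi IH]
  a /=.
- apply: iff_trans (gr _ _); suff -> :
      [tuple eval_term M (map_tuple g a) (ts i) | i < rel_arity r] =
      map_tuple g [tuple eval_term M a (ts i) | i < rel_arity r] by exact: iff_refl.
  by apply: eq_from_tnth => i; rewrite tnth_mktuple aut_eval_term tnth_map tnth_mktuple.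
- by rewrite !aut_eval_term; split=> [/(bij_inj gb)|->].
- by rewrite IH.
- by split=> + i => /(_ i)/IH.
- by split=> -[i /IH]; exists i.
- split=> -[x]; last by rewrite -IH map_tuple_cons; exists (g x).
  by rewrite -(gK x) -map_tuple_cons IH; exists (aut_inv_fun g x).
- split=> + x; first by move=> /(_ (g x)); rewrite -map_tuple_cons IH.
  by move=> /(_ (aut_inv_fun g x)); rewrite -IH map_tuple_cons gK.
Qed.

Lemma aut_definable k (S : set (k.-tuple A)) (a : k.-tuple A) :
  definable M S -> S (map_tuple g a) <-> S a.
Proof. by move=> [phi Sphi]; rewrite !Sphi aut_sat. Qed.

Lemma aut_definable2 k (R : k.-tuple A -> k.-tuple A -> Prop) (a b : k.-tuple A) :
  definable2 M R -> R (map_tuple g a) (map_tuple g b) <-> R a b.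
Proof. by move=> [phi Rphi]; rewrite !Rphi -map_tuple_cat aut_sat. Qed.

Lemma aut_definable_elt (x : A) : definable_elt M x -> g x = x.
Proof.
move=> xdef; have : [set [tuple x]] (map_tuple g [tuple x]).
  exact/(aut_definable _ xdef).
by move=> /(congr1 val) [].
Qed.

End Automorphisms.

(** * Infinitary types, conjugacy, and definability of invariant relations *)

Section Types.
Variables (L : language) (A : countType) (M : structure L A).

Definition same_type k (a b : k.-tuple A) : Prop :=
  forall phi : formula L k, sat M phi a <-> sat M phi b.

(* Since A^k is countable, the conjunction over all tuples of one formula
   separating each from [a] is still in L_{omega_1 omega}; this avoids the
   transfinite recursion of Scott's analysis and any countability of [L]. *)
Lemma isolating_formula k (a : k.-tuple A) :
  exists theta : formula L k, forall b, sat M theta b <-> same_type a b.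
Proof.
have /choice[phi phiP] (b : k.-tuple A) : exists phi : formula L k,
    sat M phi a /\ (sat M phi b -> same_type a b).
  have [ab|/existsNP[phi nphi]] := pselect (same_type a b).
    by exists (FAnd (fun x : void => match x with end)); split.
  have [pa|npa] := pselect (sat M phi a).
    by exists phi; split=> // pb; case: nphi.
  by exists (FNot phi); split=> // npb; case: nphi.
exists (FAnd (J := k.-tuple A) phi) => b /=; split=> [/(_ b)|ab i].
  by have [] := phiP b.
by apply/(ab (phi i)); have [] := phiP i.
Qed.

(** Quantify existentially the formula isolating the type of [x :: a]: the result holds at [a],
    hence at [b], and its witness there is [y]. *)
Lemma same_type_extend k (a b : k.-tuple A) (x : A) : same_type a b ->
  exists y, same_type [tuple of x :: a] [tuple of y :: b].
Proof.
move=> ab; have [theta thetaP] := isolating_formula [tuple of x :: a].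
have /(ab (FEx theta))[y] : sat M (FEx theta) a by exists x; apply/thetaP.
by move=> /thetaP; exists y.
Qed.

Lemma same_type_sym k (a b : k.-tuple A) : same_type a b -> same_type b a.
Proof. by move=> ab phi; apply: iff_sym. Qed.

Lemma same_type_val k k' (a b : k.-tuple A) (a' b' : k'.-tuple A) :
  a = a' :> seq A -> b = b' :> seq A -> same_type a b -> same_type a' b'.
Proof.
move=> aa' bb'; have ek : k = k' by rewrite -(size_tuple a) aa' size_tuple.
by subst k'; have [<- <-] := (val_inj aa', val_inj bb').
Qed.

Definition elementary_pairs (s : seq (A * A)) : Prop :=
  same_type (map_tuple fst (in_tuple s)) (map_tuple snd (in_tuple s)).

Lemma elementary_pairs_swap (s : seq (A * A)) :
  elementary_pairs s -> elementary_pairs [seq (p.2, p.1) | p <- s].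
Proof.
by move=> /same_type_sym; apply: same_type_val; rewrite /= -map_comp.
Qed.

Lemma elementary_pairs_forth (s : seq (A * A)) (x : A) :
  elementary_pairs s -> exists y, elementary_pairs ((x, y) :: s).
Proof.
by move=> /(same_type_extend x)[y xy]; exists y; apply: same_type_val xy.
Qed.

Lemma elementary_pairs_back (s : seq (A * A)) (y : A) :
  elementary_pairs s -> exists x, elementary_pairs ((x, y) :: s).
Proof.
move=> /elementary_pairs_swap /(elementary_pairs_forth y)[x].
move=> /elementary_pairs_swap; rewrite /= -map_comp /=.
by under eq_map do rewrite /= -surjective_pairing; rewrite map_id; exists x.
Qed.

(** Turns membership of pairs in [s] into a choice of variables: a formula about [a] and [b] becomes
    one about the positions [j i] of [s]. *)
Lemma pairs_index (s : seq (A * A)) k (a b : k.-tuple A) :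
  (forall i, (tnth a i, tnth b i) \in s) ->
  exists j : 'I_k -> 'I_(size s), forall i,
    tnth (map_tuple fst (in_tuple s)) (j i) = tnth a i /\
    tnth (map_tuple snd (in_tuple s)) (j i) = tnth b i.
Proof.
move=> abs; exists (fun i => Ordinal (etrans (index_mem _ _) (abs i))) => i.
by rewrite !tnth_map (tnth_nth (tnth a i, tnth b i)) /= nth_index.
Qed.

Lemma elementary_pairs_inj (s : seq (A * A)) (p q : A * A) :
  elementary_pairs s -> p \in s -> q \in s -> (p.1 = q.1 <-> p.2 = q.2).
Proof.
move=> sP ps qs.
have [|j /all_and2[j1 j2]] := @pairs_index s 2 [tuple p.1; q.1] [tuple p.2; q.2].
  by case=> -[|[|//]] i2; rewrite !(tnth_nth p.1) /= -surjective_pairing.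
have := sP (FEq (Var _ (j ord0)) (Var _ (j ord_max))).
by rewrite /= !j1 !j2 !(tnth_nth p.1) /=.
Qed.

(** Back and forth through tuples of the same type yields a bijection, which is an automorphism
    because types contain the atomic formulas. *)
Lemma same_type_conjugate k (a b : k.-tuple A) :
  same_type a b -> exists g : aut M, map_tuple g a = b.
Proof.
move=> ab; pose s0 := zip a b.
have s0P : elementary_pairs s0.
  by apply: same_type_val ab; rewrite /= ?[map _ _]unzip1_zip ?[map _ _]unzip2_zip //
    !size_tuple.
have [g [gb gs0 gP]] := back_and_forth (@unpickle_surj A) (@unpickle_surj A)
  elementary_pairs_inj elementary_pairs_forth elementary_pairs_back s0P.
have gaut : is_automorphism M g.
  split=> // [f c|r c].
    (* The value is listed with its arguments, so that the formula equating it with [f] of the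
       arguments can be transferred. *)
    have [s sP cs] := gP (finterp M c :: c).
    have [|j /all_and2[j1 j2]] := @pairs_index s _ [tuple of finterp M c :: c]
      [tuple of g (finterp M c) :: map_tuple g c].
      move=> i; rewrite -map_tuple_cons tnth_map; apply: cs.
      exact: (mem_tnth i [tuple of finterp M c :: c]).
    have := sP (FEq (Var _ (j ord0)) (App (fun i => Var _ (j (lift ord0 i))))).
    rewrite /= j1 j2 !tnth0 => -[+ _].
    set u := mktuple _; set v := mktuple _.
    have -> : u = c by apply: eq_from_tnth => i; rewrite tnth_mktuple j1 tnthS.
    have -> : v = map_tuple g c
      by apply: eq_from_tnth => i; rewrite tnth_mktuple j2 tnthS.
    exact.
  have [s sP cs] := gP c.
  have [|j /all_and2[j1 j2]] := @pairs_index s _ c (map_tuple g c).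
    by move=> i; rewrite tnth_map; apply: cs; exact: mem_tnth.
  have := sP (FRel (fun i => Var _ (j i))).
  rewrite /=; set u := mktuple _; set v := mktuple _.
  have -> : u = c by apply: eq_from_tnth => i; rewrite tnth_mktuple j1.
  have -> : v = map_tuple g c by apply: eq_from_tnth => i; rewrite tnth_mktuple j2.
  exact: iff_sym.
exists (Aut gaut); apply: eq_from_tnth => i; rewrite tnth_map /=.
apply: (gs0 (tnth a i, tnth b i)); apply/(nthP (tnth a i, tnth b i)).
exists i; first by rewrite size_zip !size_tuple minnn.
by rewrite nth_zip ?size_tuple // -!tnth_nth.
Qed.

(** The disjunction of the formulas isolating the members of [S] defines it, because tuples of the
    same type are conjugate; it is countable since there are countably many tuples. *)
Theorem invariant_definable k (S : set (k.-tuple A)) :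
  (forall (g : aut M) a, S a -> S (map_tuple g a)) -> definable M S.
Proof.
move=> Sinv; have /choice[theta thetaP] := @isolating_formula k.
exists (FOr (J := {a : k.-tuple A | `[< S a >]}) (fun a => theta (val a))) => b.
split=> [Sb|[[a /= /asboolP Sa] /thetaP/same_type_conjugate[g <-]]].
  by exists (exist _ b (asboolT Sb)); apply/thetaP.
exact: Sinv.
Qed.

Lemma rigid_definable_elt (x : A) :
  (forall g : aut M, g x = x) -> definable_elt M x.
Proof.
move=> gx; apply: invariant_definable => g _ ->.
by apply: val_inj; rewrite /= gx.
Qed.

Lemma invariant_definable2 k (R : k.-tuple A -> k.-tuple A -> Prop) :
  (forall (g : aut M) a b, R a b -> R (map_tuple g a) (map_tuple g b)) ->
  definable2 M R.
Proof.
move=> Rinv.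
have [g c [a [b [-> Rab]]]|phi phiP] := @invariant_definable (k + k)
    [set c | exists a b : k.-tuple A, c = [tuple of a ++ b] /\ R a b].
  exists (map_tuple g a), (map_tuple g b).
  by split; [rewrite map_tuple_cat | exact: Rinv].
exists phi => a b; rewrite -phiP; split=> [Rab|[a' [b' []]]]; first by exists a, b.
move=> /(congr1 val) /= /eqP; rewrite eqseq_cat ?size_tuple // => /andP[].
by move=> /eqP/val_inj -> /eqP/val_inj ->.
Qed.

End Types.

(** * Pointwise convergence in automorphism groups *)

Lemma aut_cvgP (L : language) (A : choiceType) (M : structure L A)
    (F : set_system (aut M)) (g : aut M) : Filter F ->
  F --> g <-> forall x, \forall h \near F, aut_fun h x = g x.
Proof.
move=> FF.
have ptwsP :
    (aut_fun (M := M) @ F --> (aut_fun g : {ptws A -> discrete_topology A})) <->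
    forall x, \forall h \near F, aut_fun h x = g x.
  pose dA : topologicalType := discrete_topology A.
  apply: iff_trans (@pointwise_cvgP dA (discrete_topology A) _ _ _) _.
  split=> cv x; first by have /discrete_cvg := cv x.
  by apply/discrete_cvg; exact: cv.
apply: iff_trans ptwsP; split=> [Fg|Fg U [_ /= [[W oW <-]] Wg /filterS]].
  apply: cvg_trans; first exact: cvg_app Fg.
  exact: (@initial_continuous (aut M) {ptws A -> discrete_topology A} _ g).
by apply; apply: Fg; exact: open_nbhs_nbhs.
Qed.

Lemma aut_continuousP (L L' : language) (A B : choiceType) (M : structure L A)
    (N : structure L' B) (f : aut M -> aut N) :
  continuous f <-> forall g y, \forall h \near g, f h y = f g y.
Proof.
have fP g := @aut_cvgP _ _ N (f @ nbhs g) (f g) (fmap_filter _ (nbhs_filter g)).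
by split=> fc g; [exact: (iffLR (fP g) (fc g))|exact: (iffRL (fP g) (fc g))].
Qed.

(** * Automorphisms of the rational order *)

Lemma aut_rat_lt (p : aut rat_order) x y : (p x < p y)%R = (x < y)%R.
Proof.
have [_ _ /(_ tt [tuple x; y])] := autP p.
by rewrite /= !(tnth_nth 0%R) /= => pxy; apply/idP/idP => /pxy.
Qed.

Lemma monotone_rat_aut (p : rat -> rat) :
  bijective p -> (forall x y, (x < y)%R <-> (p x < p y)%R) ->
  exists p' : aut rat_order, aut_fun p' = p.
Proof.
move=> pb pm; have pP : is_automorphism rat_order p.
  split; [exact: pb|by case|case=> a]; rewrite /rinterp /rat_order.
  by rewrite (tnth_map p a ord0) (tnth_map p a ord_max); exact: iff_sym.
by exists (Aut pP).
Qed.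

Lemma rat_lt_strict_total_order : strict_total_order (fun x y : rat => (x < y)%R).
Proof.
split=> [x|x y z|x y]; [by rewrite ltxx|exact: lt_trans|].
by case: ltgtP; [constructor 1|constructor 3|constructor 2].
Qed.

Lemma rat_lt_dense_unbounded : dense_unbounded (fun x y : rat => (x < y)%R).
Proof.
split=> [|x y /midf_lt[? ?]|x|x]; first by exists 0%R.
- by exists ((x + y) / 2%:R)%R.
- by exists (x - 1)%R; rewrite gtrBl.
- by exists (x + 1)%R; rewrite ltrDl.
Qed.

(** Homogeneity of the rationals: Cantor's theorem between the rationals and themselves, started
    from [s]. *)
Lemma rat_aut_extension (s : seq (rat * rat)) :
  (forall p q, p \in s -> q \in s -> (p.1 < q.1)%R = (p.2 < q.2)%R) ->
  exists g : aut rat_order, forall p, p \in s -> g p.1 = p.2.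
Proof.
move=> sP.
have [|g [gb gm gs]] := @cantor_isomorphism rat rat unpickle unpickle
  (fun x y => x < y)%R (fun x y => x < y)%R s (@unpickle_surj _) (@unpickle_surj _)
  rat_lt_strict_total_order rat_lt_dense_unbounded
  rat_lt_strict_total_order rat_lt_dense_unbounded.
  move=> p q ps qs; rewrite sP //; split; first exact: iff_refl.
  (* Equality means that neither point is below the other, so it is preserved too. *)
  split=> pq; apply/eqP; rewrite eq_le !leNgt.
    by rewrite -!sP // pq ltxx.
  by rewrite !sP // pq ltxx.
by have [g' g'E] := monotone_rat_aut gb gm; exists g' => p ps; rewrite g'E gs.
Qed.

(** * From a continuous isomorphism to definable classes *)

Section IsomorphismToClasses.
Variables (L : language) (M : structure L nat).
Variable f : {multiplicative aut M -> aut rat_order}.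
Hypotheses (f_bij : bijective f) (f_cont : continuous f).

Lemma homM (g h : aut M) q : f (aut_mul g h) q = f g (f h q).
Proof.
have : f (g * h)%g = (f g * f h)%g by exact: gmulfM.
by move=> /(congr1 (fun p : aut _ => p q)).
Qed.

Lemma hom1 q : f (aut_one M) q = q.
Proof.
have [fb _ _] := autP (f (aut_one M)); apply: (bij_inj fb).
by rewrite -homM; congr (aut_fun (f _) _); exact: aut_inj.
Qed.

Lemma homV (g : aut M) q : f (aut_inv g) (f g q) = q.
Proof.
rewrite -homM -[RHS]hom1; congr (aut_fun (f _) _); apply: aut_inj.
by apply/funext => x /=; rewrite aut_inv_funK.
Qed.

Lemma f_surj (p : aut rat_order) : exists g, f g = p.
Proof. by have [h _ hK] := f_bij; exists (h p). Qed.

(** Otherwise, for each [n], some [g n] fixes all numbers below [n] while [f (g n)] moves 0. These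
    [g n] converge to the identity, so by continuity [f (g n)] eventually fixes 0, a
    contradiction. *)
Lemma f_stabilizer : exists n, forall g : aut M,
  (forall i, i < n -> g i = i) -> f g 0%R = 0%R.
Proof.
apply: contrapT => /forallNP nst.
have /choice[g gP] n : exists g : aut M,
    (forall i, i < n -> g i = i) /\ f g 0%R <> 0%R.
  by have /existsNP[g /not_implyP[]] := nst n; exists g.
have g1 : g @ \oo --> aut_one M.
  apply/aut_cvgP => x; exists x.+1 => // n /= xn.
  by have [-> //] := gP n.
have : (f \o g) @ \oo --> f (aut_one M).
  by apply: cvg_trans (@f_cont (aut_one M)); exact: cvg_app g1.
move=> /aut_cvgP/(_ 0%R)[n _ /(_ n (leqnn n))] /=.
by rewrite hom1; have [] := gP n.
Qed.

Variables (n : nat) (a : n.-tuple nat).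
Hypothesis a_stab : forall g : aut M, map_tuple g a = a -> f g 0%R = 0%R.

(* [orbit_point b q] is the graph of the equivariant surjection g a |-> f g 0
   of the orbit of [a] onto the rationals; its fibres are the classes. *)
Definition orbit_point (b : n.-tuple nat) (q : rat) : Prop :=
  exists2 g : aut M, b = map_tuple g a & q = f g 0%R.

Definition fibre (q : rat) : set (n.-tuple nat) := [set b | orbit_point b q].

Definition same_fibre (b c : n.-tuple nat) : Prop :=
  exists2 q, orbit_point b q & orbit_point c q.

Definition fibre_lt (C C' : set (n.-tuple nat)) : Prop :=
  exists q q', [/\ C = fibre q, C' = fibre q' & (q < q')%R].

Definition orbit : set (n.-tuple nat) := [set b | exists q, orbit_point b q].

(** If [g a = h a], then [h^-1 g] stabilizes [a], so its image under [f] fixes 0 and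
    [f g 0 = f h 0]. *)
Lemma orbit_point_fun b q q' : orbit_point b q -> orbit_point b q' -> q = q'.
Proof.
move=> [g -> ->] [h gh ->].
have : f (aut_mul (aut_inv h) g) 0%R = 0%R.
  by apply: a_stab; rewrite map_tuple_aut_mul gh map_tuple_autK.
rewrite homM => hg; have [hb _ _] := autP (f (aut_inv h)).
by apply: (bij_inj hb); rewrite hg homV.
Qed.

Lemma orbit_point_surj q : exists b, orbit_point b q.
Proof.
have [|p pP] := @rat_aut_extension [:: (0%R, q)].
  by move=> r s; rewrite !inE => /eqP -> /eqP ->; rewrite !ltxx.
have [g gp] := f_surj p; exists (map_tuple g a), g => //.
by rewrite gp (pP (0%R, q)) ?mem_head.
Qed.

Lemma orbit_point_aut (g : aut M) b q :
  orbit_point b q -> orbit_point (map_tuple g b) (f g q).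
Proof.
by move=> [h -> ->]; exists (aut_mul g h); rewrite ?map_tuple_aut_mul ?homM.
Qed.

Lemma fibre_inj : injective fibre.
Proof.
move=> q q' qq'; have [b bq] := orbit_point_surj q.
by apply: (orbit_point_fun bq); rewrite -[orbit_point _ _]/(fibre q' b) -qq'.
Qed.

Lemma fibre_lt_fibre q q' : fibre_lt (fibre q) (fibre q') <-> (q < q')%R.
Proof.
split=> [[r [r' [/fibre_inj -> /fibre_inj ->]]] //|qq'].
by exists q, q'; split.
Qed.

Lemma eclass_fibre b q : orbit_point b q -> eclass same_fibre b = fibre q.
Proof.
move=> bq; apply/seteqP; split=> c /= => [[r br cr]|cq]; last by exists q.
by rewrite /fibre /= (orbit_point_fun bq br).
Qed.

Lemma eclasses_fibre C : eclasses orbit same_fibre C <-> exists q, C = fibre q.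
Proof.
split=> [[b [q bq] <-]|[q ->]]; first by exists q; exact: eclass_fibre.
have [b bq] := orbit_point_surj q; exists b; first by exists q.
exact: eclass_fibre.
Qed.

(** Equivariance; through it, questions about the action on the classes become questions about
    automorphisms of the rationals. *)
Lemma image_fibre (g : aut M) q :
  [set map_tuple g b | b in fibre q] = fibre (f g q).
Proof.
apply/seteqP; split=> [_ [b bq <-]|c cq]; first exact: orbit_point_aut.
exists (map_tuple (aut_inv g) c); last exact: map_tuple_autKV.
by rewrite /fibre /= -(homV g q); exact: (orbit_point_aut (aut_inv g) cq).
Qed.

Lemma orbit_definable : definable M orbit.
Proof.
apply: invariant_definable => g b [q bq]; exists (f g q).
exact: orbit_point_aut.
Qed.

Lemma same_fibre_definable : definable2 M same_fibre.
Proof.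
apply: invariant_definable2 => g b c [q bq cq].
by exists (f g q); exact: orbit_point_aut.
Qed.

Lemma same_fibre_equivalence : equivalence_on orbit same_fibre.
Proof.
split=> [b c [q ? ?]|b [q ?]|b c [q ? ?]|b c d [q bq cq] [r cr dr]].
- by split; exists q.
- by exists q.
- by exists q.
- by exists q => //; rewrite (orbit_point_fun cq cr).
Qed.

Lemma infinite_fibres : infinite_set (eclasses orbit same_fibre).
Proof.
have -> : eclasses orbit same_fibre = fibre @` [set: rat].
  apply/seteqP; split=> C; first by move=> /eclasses_fibre[q ->]; exists q.
  by move=> [q _ <-]; apply/eclasses_fibre; exists q.
rewrite (eq_finite_set (inj_card_eq (in2W fibre_inj))); exact: infinite_rat.
Qed.

Lemma fibre_lt_definable :
  definable2 M (fun b c => orbit b /\ orbit c /\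
    fibre_lt (eclass same_fibre b) (eclass same_fibre c)).
Proof.
apply: invariant_definable2 => g b c [[q bq] [[r cr]]].
rewrite (eclass_fibre bq) (eclass_fibre cr) => /fibre_lt_fibre qr.
have bq' := orbit_point_aut g bq; have cr' := orbit_point_aut g cr.
split; first by exists (f g q).
split; first by exists (f g r).
rewrite (eclass_fibre bq') (eclass_fibre cr').
by apply/fibre_lt_fibre; rewrite aut_rat_lt.
Qed.

Lemma fibre_lt_linear : strict_linear_order_on_classes orbit same_fibre fibre_lt.
Proof.
have [irr tr tot] := rat_lt_strict_total_order.
split=> [_ /eclasses_fibre[q ->]
  |_ _ _ /eclasses_fibre[q ->] /eclasses_fibre[r ->] /eclasses_fibre[s ->]
  |_ _ /eclasses_fibre[q ->] /eclasses_fibre[r ->]].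
- by move=> /fibre_lt_fibre/irr.
- by move=> /fibre_lt_fibre qr /fibre_lt_fibre rs; apply/fibre_lt_fibre/(tr _ r).
- have [qr|->|rq] := tot q r; [constructor 1|by constructor 2|constructor 3];
  exact/fibre_lt_fibre.
Qed.

(** Both clauses are transferred to the rationals along [fibre]: the first is homogeneity, the
    second holds because an order-preserving permutation of the rationals is an automorphism.
    Surjectivity of [f] then supplies [g]. *)
Lemma fibre_order_indiscernible : order_indiscernible orbit same_fibre fibre_lt M.
Proof.
split=> [k C C' [CP Cm] [C'P C'm]|h [[hfun hinj hsurj] hm]].
  have /choice[q qP] i : exists q, C i = fibre q by apply/eclasses_fibre.
  have /choice[r rP] i : exists q, C' i = fibre q by apply/eclasses_fibre.
  have qm (i j : 'I_k) : (i < j)%N -> (q i < q j)%R.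
    by move=> /Cm; rewrite !qP => /fibre_lt_fibre.
  have rm (i j : 'I_k) : (i < j)%N -> (r i < r j)%R.
    by move=> /C'm; rewrite !rP => /fibre_lt_fibre.
  have [|p pP] := @rat_aut_extension [seq (q i, r i) | i <- enum 'I_k].
    move=> _ _ /mapP[i _ ->] /mapP[j _ ->] /=.
    case: (ltngtP i j) => [ij|ji|/val_inj ->]; last by rewrite !ltxx.
      by rewrite qm // rm.
    by rewrite !ltNge !ltW ?qm ?rm.
  have [g gp] := f_surj p; exists g => i; rewrite qP rP image_fibre gp.
  by rewrite (pP (q i, r i)) //; apply/map_f/mem_enum.
have fibreP q : eclasses orbit same_fibre (fibre q) by apply/eclasses_fibre; exists q.
have /choice[p pP] q : exists r, h (fibre q) = fibre r.
  by apply/eclasses_fibre/hfun.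
have pm q r : (q < r)%R -> (p q < p r)%R.
  move=> qr; apply/fibre_lt_fibre; rewrite -!pP; apply: hm => //.
  exact/fibre_lt_fibre.
have /choice[p' p'K] q : exists r, p r = q.
  have [_ /eclasses_fibre[r ->]] := hsurj _ (fibreP q).
  by rewrite pP => /fibre_inj; exists r.
have pm' q r : (q < r)%R <-> (p q < p r)%R.
  split=> [/pm //|]; rewrite !ltNge; apply: contraNN.
  by rewrite le_eqVlt => /predU1P[->|/pm/ltW].
(* The right inverse [p'] of the increasing map [p] is also a left inverse: [p (p' (p q)) = p q]
   excludes both strict inequalities. *)
have pb : bijective p.
  exists p' => // q; have := p'K (p q); have pqr := pm (p' (p q)) q.
  have := pm q (p' (p q)); case: ltgtP pqr => // _ lt1 lt2 e.
    by have := lt1 erefl; rewrite e ltxx.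
  by have := lt2 erefl; rewrite e ltxx.
have [p1 p1E] := monotone_rat_aut pb pm'; have [g gp] := f_surj p1.
exists g => _ /eclasses_fibre[q ->].
by rewrite image_fibre pP gp p1E.
Qed.

(** An automorphism of the expansion preserves every fibre, so its image under [f] fixes every
    rational and it is the identity; in a rigid structure every element is definable. *)
Lemma definable_from_fibres x :
  definable_elt (naming_expansion M (eclasses orbit same_fibre)) x.
Proof.
apply: rigid_definable_elt => g; have [gb gf gr] := autP g.
have gM : is_automorphism M g by split=> // r; exact: (gr (inl r)).
pose g' := Aut gM; suff : g' = aut_one M by move=> /(congr1 (fun h : aut M => h x)).
apply: (bij_inj f_bij); apply: aut_inj; apply/funext => q; rewrite hom1.
have [b bq] := orbit_point_surj q.
have qP : fibre q \in eclasses orbit same_fibre.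
  by apply/mem_set/eclasses_fibre; exists q.
(* The tuple [g b] lies over [f g q] by equivariance, and over [q] because [g] preserves the
   relation naming [fibre q]. *)
apply: (orbit_point_fun (orbit_point_aut g' bq)).
exact/(gr (inr (SigSub qP)) b).
Qed.

End IsomorphismToClasses.

(** * From order indiscernible classes to a continuous isomorphism *)

Section ClassesToIsomorphism.
Variables (L : language) (M : structure L nat) (n : nat) (D : set (n.-tuple nat)).
Variables (E : n.-tuple nat -> n.-tuple nat -> Prop).
Variable lt : set (n.-tuple nat) -> set (n.-tuple nat) -> Prop.
Hypotheses (D_def : definable M D) (E_def : definable2 M E)
  (E_inf : infinite_set (eclasses D E))
  (lt_def : definable2 M (fun a b => D a /\ D b /\ lt (eclass E a) (eclass E b)))
  (lt_linear : strict_linear_order_on_classes D E lt)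
  (indisc : order_indiscernible D E lt M)
  (elt_def : forall x, definable_elt (naming_expansion M (eclasses D E)) x).

Let class : choiceType := set_type (eclasses D E).
Let class_lt (C C' : class) : Prop := lt (\val C) (\val C').

Lemma class_eq (C C' : class) : \val C = \val C' -> C = C'.
Proof. exact: val_inj. Qed.

Lemma class_of (C : set (n.-tuple nat)) :
  eclasses D E C -> exists K : class, \val K = C.
Proof. by move=> CP; exists (SigSub (mem_set CP)). Qed.

(** [E] is definable, hence invariant, so a class is mapped onto a whole class. *)
Lemma image_eclass (g : aut M) a :
  [set map_tuple g b | b in eclass E a] = eclass E (map_tuple g a).
Proof.
apply/seteqP; split=> [_ [b ab <-]|b gab].
  exact/(aut_definable2 g a b E_def).
exists (map_tuple (aut_inv g) b); last exact: map_tuple_autKV.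
by apply/(aut_definable2 g _ _ E_def); rewrite map_tuple_autKV.
Qed.

Lemma image_class (g : aut M) (C : class) :
  exists C' : class, \val C' = [set map_tuple g a | a in \val C].
Proof.
apply: class_of; have [a Da <-] := set_valP C.
exists (map_tuple g a); last by rewrite image_eclass.
exact/(aut_definable g a D_def).
Qed.

Definition class_act (g : aut M) (C : class) : class := projT1 (cid (image_class g C)).

Lemma class_actE (g : aut M) (C : class) :
  \val (class_act g C) = [set map_tuple g a | a in \val C].
Proof. by rewrite /class_act; case: (cid _). Qed.

Lemma class_actM (g h : aut M) (C : class) :
  class_act (aut_mul g h) C = class_act g (class_act h C).
Proof.
apply: class_eq; rewrite !class_actE; apply/seteqP.
split=> [_ [a Ca <-]|_ [_ [a Ca <-] <-]].
  by exists (map_tuple h a); [exists a|rewrite map_tuple_aut_mul].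
by exists a; rewrite ?map_tuple_aut_mul.
Qed.

Lemma class_act1 (C : class) : class_act (aut_one M) C = C.
Proof.
have E1 (a : n.-tuple nat) : map_tuple (aut_one M) a = a.
  by apply: val_inj; rewrite /= map_id.
apply: class_eq; rewrite class_actE; apply/seteqP; split=> [_ [a Ca <-]|a Ca].
  by rewrite E1.
by exists a; rewrite ?E1.
Qed.

Lemma class_actK (g : aut M) : cancel (class_act g) (class_act (aut_inv g)).
Proof.
move=> C; rewrite -class_actM -[RHS]class_act1; congr class_act.
by apply: aut_inj; apply/funext => x /=; rewrite aut_inv_funK.
Qed.

Lemma class_actKV (g : aut M) : cancel (class_act (aut_inv g)) (class_act g).
Proof.
move=> C; rewrite -class_actM -[RHS]class_act1; congr class_act.
by apply: aut_inj; apply/funext => x /=; rewrite aut_funK.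
Qed.

Lemma class_act_lt (g : aut M) (C C' : class) :
  class_lt C C' -> class_lt (class_act g C) (class_act g C').
Proof.
rewrite /class_lt !class_actE.
have [[a Da <-] [b Db <-]] := (set_valP C, set_valP C').
rewrite !image_eclass => ab; have : D a /\ D b /\ lt (eclass E a) (eclass E b) by [].
by move=> /(aut_definable2 g a b lt_def)[_ []].
Qed.

Lemma class_act_conjugate1 (C C' : class) : exists g, class_act g C = C'.
Proof.
have [conj _] := indisc; have [||g gP] := conj 1%N (fun=> \val C) (fun=> \val C').
- by split=> [_|i j]; [exact: set_valP | rewrite !ord1].
- by split=> [_|i j]; [exact: set_valP | rewrite !ord1].
- by exists g; apply: class_eq; rewrite class_actE (gP ord0).
Qed.

Lemma class_act_conjugate2 (C1 C2 C1' C2' : class) :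
  class_lt C1 C2 -> class_lt C1' C2' ->
  exists g, class_act g C1 = C1' /\ class_act g C2 = C2'.
Proof.
move=> lt12 lt12'.
pose pair (K1 K2 : class) (i : 'I_2) := if i == ord0 then \val K1 else \val K2.
have pairP K1 K2 : class_lt K1 K2 -> increasing_classes D E lt (pair K1 K2).
  move=> ltK; split=> [i|i j]; first by rewrite /pair; case: ifP => _; exact: set_valP.
  by case: i j => [[|[|//]] ?] [[|[|//]] ?].
have [conj _] := indisc.
have [g gP] := conj 2 _ _ (pairP _ _ lt12) (pairP _ _ lt12').
exists g; split; apply: class_eq; rewrite class_actE; first exact: (gP ord0).
exact: (gP ord_max).
Qed.

Lemma class_lt_strict_total_order : strict_total_order class_lt.
Proof.
have [irr tr tot] := lt_linear; split=> [C|C1 C2 C3|C1 C2].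
- by apply: irr; exact: set_valP.
- by apply: tr; exact: set_valP.
- have [?|/class_eq ?|?] := tot _ _ (set_valP C1) (set_valP C2).
  + by constructor 1.
  + by constructor 2.
  + by constructor 3.
Qed.

(** One chain of three classes serves as a pattern, whose copies under automorphisms give density
    and unboundedness. *)
Lemma three_classes : exists C1 C2 C3, class_lt C1 C2 /\ class_lt C2 C3.
Proof.
have [_ _ tot] := class_lt_strict_total_order.
have new (s : seq (set (n.-tuple nat))) : exists C : class, \val C \notin s.
  have [C [/class_of[K <-] /= Ks]] :=
    infinite_setN0 (infinite_setD E_inf (finite_seq s)).
  by exists K; apply/negP.
have [C1 _] := new [::]; have [C2] := new [:: \val C1].
have [C3] := new [:: \val C1; \val C2]; rewrite !inE.
move=> /norP[/eqP n31 /eqP n32] /eqP n21.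
have {}n31 : C3 <> C1 by move=> /(congr1 val).
have {}n32 : C3 <> C2 by move=> /(congr1 val).
have {}n21 : C2 <> C1 by move=> /(congr1 val).
have [l12|/esym//|l21] := tot C1 C2; have [l13|/esym//|l31] := tot C1 C3;
  have [l23|/esym//|l32] := tot C2 C3.
- by exists C1, C2, C3.
- by exists C1, C3, C2.
- by exists C3, C1, C2.
- by exists C3, C1, C2.
- by exists C2, C1, C3.
- by exists C2, C1, C3.
- by exists C2, C3, C1.
- by exists C3, C2, C1.
Qed.

(** For density, move the ends of the chain onto the given pair and take the image of the middle;
    for unboundedness, move the middle onto the given class and take the image of an end. *)
Lemma class_lt_dense_unbounded : dense_unbounded class_lt.
Proof.
have [C1 [C2 [C3 [lt12 lt23]]]] := three_classes.
have [_ tr _] := class_lt_strict_total_order.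
split=> [|C C' CC'|C|C]; first by exists C1.
- have [g [<- <-]] := class_act_conjugate2 (tr _ _ _ lt12 lt23) CC'.
  by exists (class_act g C2); split; exact: class_act_lt.
- have [g <-] := class_act_conjugate1 C2 C.
  by exists (class_act g C1); exact: class_act_lt.
- have [g <-] := class_act_conjugate1 C2 C.
  by exists (class_act g C3); exact: class_act_lt.
Qed.

Lemma class_enumeration :
  exists e : nat -> option class, forall C, exists k, e k = Some C.
Proof.
have /choice[e eP] k : exists o : option class,
    forall a : n.-tuple nat, unpickle k = Some a -> D a ->
      exists2 C : class, o = Some C & \val C = eclass E a.
  case: (unpickle k) => [a|]; last by exists None.
  have [Da|nDa] := pselect (D a); last by exists None => _ [<-].
  have [C CP] := @class_of (eclass E a) (ex_intro2 _ _ a Da erefl).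
  by exists (Some C) => _ [<-] _; exists C.
exists e => C; have [a Da aC] := set_valP C.
have [K eK KC] := eP (pickle a) a (pickleK a) Da.
by exists (pickle a); rewrite eK; congr Some; apply: class_eq; rewrite KC.
Qed.

(** The classes form a countable dense order without endpoints, so the action on them is transported
    to the rationals along an isomorphism [s] with inverse [t]. *)
Lemma classes_isomorphism :
  exists f : {multiplicative aut M -> aut rat_order}, bijective f /\ continuous f.
Proof.
have [e eP] := class_enumeration.
have [//|s [[t sK tK] s_lt _]] := @cantor_isomorphism class rat e unpickle class_lt
  (fun x y => x < y)%R [::] eP (@unpickle_surj _) class_lt_strict_total_order
  class_lt_dense_unbounded rat_lt_strict_total_order rat_lt_dense_unbounded.
have /choice[f fE] (g : aut M) :
    exists p : aut rat_order, aut_fun p = fun q => s (class_act g (t q)).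
  apply: monotone_rat_aut => [|x y].
    exists (fun q => s (class_act (aut_inv g) (t q))) => q.
      by rewrite sK class_actK tK.
    by rewrite sK class_actKV tK.
  rewrite -[in X in X <-> _](tK x) -[in X in X <-> _](tK y) -!s_lt.
  split; first exact: class_act_lt.
  by move=> /(class_act_lt (aut_inv g)); rewrite !class_actK.
have f_mul : {morph f : g h / (g * h)%g >-> (g * h)%g}.
  move=> g h; apply: aut_inj; apply/funext => q.
  by rewrite fE /= !fE sK class_actM.
pose fm : {multiplicative aut M -> aut rat_order} :=
  HB.pack f (isMultiplicative.Build _ _ f f_mul).
have fP g C : f g (s C) = s (class_act g C) by rewrite fE sK.
have f_surj p : exists g, f g = p.
  have [_ ext] := indisc.
  (* The extension property takes maps on all sets of tuples: [h] is the conjugate of [p] by [s] on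
     the classes, with the empty set as default value elsewhere. *)
  have /choice[h hP] (C : set (n.-tuple nat)) : exists C' : set (n.-tuple nat),
      forall K : class, \val K = C -> C' = \val (t (p (s K))).
    have [[K <-]|nK] := pselect (exists K : class, \val K = C).
      by exists (\val (t (p (s K)))) => K' /class_eq ->.
    by exists set0 => K KC; case: nK; exists K.
  have [|g gP] := ext h.
    have pK := aut_inv_funK p; have pKV := aut_funK p.
    split; first split.
    - by move=> _ /class_of[K <-]; rewrite (hP _ K erefl); exact: set_valP.
    - move=> _ _ /set_mem/class_of[K <-] /set_mem/class_of[K' <-].
      rewrite (hP _ K erefl) (hP _ K' erefl) => /class_eq/(congr1 s).
      by rewrite !tK => /(can_inj pK)/(can_inj sK) ->.
    - move=> _ /class_of[K <-]; exists (\val (t (aut_inv p (s K)))).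
        exact: set_valP.
      by rewrite (hP _ _ erefl) tK pKV sK.
    - move=> _ _ /class_of[K <-] /class_of[K' <-] KK'.
      rewrite (hP _ K erefl) (hP _ K' erefl).
      by apply/s_lt; rewrite !tK aut_rat_lt; apply/s_lt.
  exists g; apply: aut_inj; apply/funext => q; rewrite -(tK q) fP -[RHS]tK; congr s.
  apply: class_eq; rewrite class_actE gP; last exact: set_valP.
  exact: hP.
have f_inj g h : f g = f h -> g = h.
  move=> fgh; have actE C : class_act g C = class_act h C.
    by apply: (can_inj sK); rewrite -!fP fgh.
  (* The quotient [k] fixes every class, so it is an automorphism of the expansion and fixes every
     definable element, that is, every element. *)
  pose k := aut_mul (aut_inv h) g.
  have kC (C : class) : class_act k C = C by rewrite class_actM actE class_actK.
  have kC' (C : class) a : (\val C) a -> (\val C) (map_tuple k a).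
    by move=> Ca; rewrite -(kC C) class_actE; exists a.
  have [kb kf kr] := autP k.
  have kP : is_automorphism (naming_expansion M (eclasses D E)) k.
    split=> // -[r a|C a]; first exact: kr.
    split=> /= [Cka|Ca]; last exact: kC'.
    have : (\val (class_act k C)) (map_tuple k a) by rewrite kC.
    rewrite class_actE => -[b Cb kba].
    by rewrite -(map_tuple_autK k a) -kba map_tuple_autK.
  apply: aut_inj; apply/funext => x.
  have : aut_fun (Aut kP) x = x by exact: aut_definable_elt.
  by move=> /(congr1 h) /=; rewrite aut_funK.
exists fm; split.
  have /choice[f' f'K] := f_surj; exists f' => // g.
  by apply: f_inj; exact: f'K.
(* The value [f h q] depends only on [h a], for one representative [a] of the class [t q]; agreeing
   with [g] on the finitely many entries of [a] is a condition that holds near [g]. *)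
apply/aut_continuousP => g q.
have [a Da aC] := set_valP (t q).
have near_a : \forall h \near g, map_tuple (aut_fun h) a = map_tuple g a.
  have cg : nbhs g --> g by [].
  have near_x := iffLR (aut_cvgP _ _) cg.
  have : \forall h \near g, forall i : 'I_n, aut_fun h (tnth a i) = g (tnth a i).
    apply: (@filter_forall _ _ (fun (i : 'I_n) (h : aut M) =>
      aut_fun h (tnth a i) = g (tnth a i)) _ (nbhs_filter g)) => i; exact: near_x.
  apply: filterS => h hP; apply: eq_from_tnth => i; rewrite !tnth_map; exact: hP.
move: near_a; apply: filterS => h ha.
rewrite /= -(tK q) !fP; congr s; apply: class_eq.
by rewrite !class_actE -aC !image_eclass ha.
Qed.

End ClassesToIsomorphism.

(** * Both implications combined *)

Theorem theorem4p3 (L : language) (M : structure L nat) :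
  (exists f : {multiplicative aut M -> aut rat_order},
      bijective f /\ continuous f)
  <->
  (exists (n : nat) (D : set (n.-tuple nat))
          (E : n.-tuple nat -> n.-tuple nat -> Prop)
          (lt : set (n.-tuple nat) -> set (n.-tuple nat) -> Prop),
      definable M D /\
      (definable2 M E /\ equivalence_on D E) /\
      infinite_set (eclasses D E) /\
      (definable2 M (fun a b => D a /\ D b /\ lt (eclass E a) (eclass E b)) /\
       strict_linear_order_on_classes D E lt) /\
      order_indiscernible D E lt M /\
      (forall x : nat, definable_elt (naming_expansion M (eclasses D E)) x)).
Proof.
split=> [[f [f_bij f_cont]]|[n [D [E [lt]]]]]; last first.
  by move=> [? [[? ?] [? [[? ?] [? ?]]]]]; exact: (@classes_isomorphism L M n D E lt).
have [n nP] := f_stabilizer f_cont.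
(* The stabilizer of the tuple of all numbers below [n] consists of the automorphisms fixing each of
   them. *)
pose a : n.-tuple nat := [tuple val i | i < n].
have a_stab (g : aut M) : map_tuple g a = a -> f g 0%R = 0%R.
  move=> ga; apply: nP => i lt_in.
  have := congr1 (fun b => tnth b (Ordinal lt_in)) ga.
  by rewrite tnth_map tnth_mktuple.
exists n, (orbit f a), (same_fibre f a), (fibre_lt f a).
split; first exact: orbit_definable.
split; first by split; [exact: same_fibre_definable|exact: same_fibre_equivalence].
split; first exact: infinite_fibres.
split; first by split; [exact: fibre_lt_definable|exact: fibre_lt_linear].
split; first exact: fibre_order_indiscernible.
exact: definable_from_fibres.
Qed.
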